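(* Let $G=(V,E)$ be an infinite, connected, locally finite simple graph with root $y_1\in V$ and with sets $V_{0,n}$, $V_n$, $V_\infty$ as in the context, such that every edge of $G$ has one endpoint in $V_\infty$ and the other in $V\setminus V_\infty$. Assume that for every integer $n\ge 0$ one has $N_y^{(0)}=\emptyset$ for all $y\in\overrightarrow{\partial}V_n$, and $N_y^{(s)}\cap N_z^{(s)}=\emptyset$ for all $y,z\in\overrightarrow{\partial}V_n$ with $y\neq z$. Let $\varphi^{(0)}=\bigotimes_{x\in V}\varphi^{(0)}_x$ be a product state on $\mathcal A_V$ (each $\varphi_x^{(0)}$ a state on $\mathcal A_x$), and for each $y\in V_\infty$ let $\mathcal E_y$ be a Markov transition expectation with respect to the triplet $(\mathcal A_{\{y\}\cup N_y},\mathcal A_{N_y^{(s)}},\mathcal A_{\{y\}\cup N_y^{(p)}})$, so that $\mathcal E_y(\mathcal A_{\{y\}\cup N_y})\subseteq\mathcal A_{N_y^{(s)}}$. Fix an enumeration $\overrightarrow{\partial}V_n=\{y^{(n)}_1,\dots,y^{(n)}_{|\overrightarrow{\partial}V_n|}\}$ for every $n\ge 0$, and let $\varphi_n$ ($n\ge 0$) be the states on $\mathcal A_V$ defined in the context. Assume that for each $y\in V_\infty$ $$\varphi^{(0)}_{N_y^{(s)}}\circ\mathcal E_y\bigl(a\otimes \mathbf 1_{y}\otimes\mathbf 1_{N_y^{(s)}}\bigr)=\varphi^{(0)}_{N_y^{(p)}}(a)\qquad\text{for all } a\in\mathcal A_{N_y^{(p)}} .$$ Then there exists a unique forward quantum Markov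 field $\varphi$ associated with the couple $(\varphi^{(0)},(\mathcal E_y)_{y\in V_\infty})$. Moreover, the sequence of states $(\varphi_n)_n$ converges in the strongly finite sense to a unique state $\varphi$ on $\mathcal A_V$.
   Context: Graph notation. $x\sim y$ means $\{x,y\}\in E$; $N_y=\{x\in V: x\sim y\}$; locally finite means every $N_y$ is finite. For $\Lambda\subseteq V$: $\overleftarrow{\partial}\Lambda=\{x\in\Lambda:\exists y\in\Lambda^c,\ x\sim y\}$, $\overrightarrow{\partial}\Lambda=\{y\in\Lambda^c:\exists x\in\Lambda,\ x\sim y\}$, $\overline\Lambda=\Lambda\cup\overrightarrow{\partial}\Lambda$. Tessellation. Fix a root $y_1\in V$. Put $V_{0,1}=\{y_1\}$ and inductively, for $n\ge1$, $V_n=\overline{V_{0,n}}=\bigcup_{y\in V_{0,n}}(\{y\}\cup N_y)$ and $V_{0,n+1}=V_{0,n}\cup\overrightarrow{\partial}V_n$. Put $V_\infty=\bigcup_{n\ge1}V_{0,n}$. By convention, for $n=0$: $V_0=\emptyset$, $\overleftarrow{\partial}V_0=\emptyset$, $\overrightarrow{\partial}V_0=\{y_1\}$; thus $V_\infty=\bigcup_{n\ge0}\overrightarrow{\partial}V_n$. For $n\ge0$ and $y\in\overrightarrow{\partial}V_n$: $N_y^{(p)}=N_y\cap\overleftarrow{\partial}V_n$, $N_y^{(s)}=N_y\cap\overleftarrow{\partial}V_{n+1}$, $N_y^{(0)}=N_y\setminus(N_y^{(p)}\cup N_y^{(s)})$. Algebras. To each $x\in V$ is attached a finite-dimensional (unital)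 $C^*$-algebra $\mathcal A_x$. For finite $\Lambda\subset V$, $\mathcal A_\Lambda=\bigotimes_{x\in\Lambda}\mathcal A_x$ (with $\mathcal A_\emptyset=\mathbb C$). $\mathcal A_V$ is the quasi-local algebra, i.e. the $C^*$-inductive limit of the $\mathcal A_\Lambda$ ($\Lambda$ finite) under the embeddings $a\mapsto a\otimes\mathbf 1$; each $\mathcal A_\Lambda$ is identified with its image in $\mathcal A_V$. For infinite $\Lambda$, $\mathcal A_\Lambda$ is the $C^*$-subalgebra of $\mathcal A_V$ generated by the $\mathcal A_{\Lambda'}$, $\Lambda'\subset\Lambda$ finite. For $\Lambda\subseteq V$, $\varphi^{(0)}_\Lambda=\bigotimes_{x\in\Lambda}\varphi^{(0)}_x$ is the product state on $\mathcal A_\Lambda$. Transition expectations. A transition expectation is a completely positive, identity preserving map $\mathcal E:\mathcal A\to\mathcal B$ between $C^*$-algebras (here subalgebras of $\mathcal A_V$). It is a Markov transition expectation with respect to the triplet $(\mathcal A,\mathcal B,\mathcal C)$, $\mathcal C$ a $C^*$-subalgebra of $\mathcal A$, if $\mathcal E(\mathcal C'\cap\mathcal A)\subseteq\mathcal C'\cap\mathcal B$, where $\mathcal C'$ is the commutant. Each $\mathcal E_y$ is extended to $\mathcal A_V=\mathcal A_{\{y\}\cup N_y}\otimes\mathcal A_{(\{y\}\cup N_y)^c}$ by acting as the identity on the second factor; compositions are understood in this sense. Level maps and states. For $n\ge0$, $\mathcal E_{n,n+1}=\mathcal E_{y^{(n)}_{|\overrightarrow{\partial}V_n|}}\circ\cdots\circ\mathcal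 E_{y^{(n)}_1}$, and $\varphi_n=\varphi^{(0)}_{V_{n+1}^c}\circ\mathcal E_{n,n+1}\circ\cdots\circ\mathcal E_{0,1}$, where the composition $\mathcal E_{n,n+1}\circ\cdots\circ\mathcal E_{0,1}$ is regarded as a Markov transition expectation with respect to the triplet $(\mathcal A_V,\mathcal A_{V_{n+1}^c},\mathcal A_{V_{n+1}})$, so that $\varphi_n$ is a state on $\mathcal A_V$. Forward quantum Markov field. A forward quantum Markov field associated with $(\varphi^{(0)},(\mathcal E_y)_{y\in V_\infty})$ is any limit point, in the topology of pointwise convergence on $\mathcal A_V$, of the sequence of states $(\varphi_n)_n$. A sequence $(\varphi_n)$ of states on $\mathcal A_V$ is convergent in the strongly finite sense if for any $a\in\mathcal A_V$ there exists $n_a\in\mathbb N$ such that $\varphi_n(a)=\varphi_{n_a}(a)$ for any $n\ge n_a$.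
   Formalization: Strongly finite convergence is claimed only for local observables (it fails for general a in A_V), with pointwise convergence on all of A_V added; φ_n applies the product state φ^(0) to the range of the composed maps, which is not contained in A_{V_{n+1}^c}. *)

(* Defs.v *)
From HB Require Import structures.
From mathcomp Require Import all_boot all_order all_algebra.
From mathcomp Require Import complex.
From mathcomp Require Import all_classical all_reals all_analysis.
Set Implicit Arguments.
Unset Strict Implicit.
Unset Printing Implicit Defensive.
Import Order.TTheory GRing.Theory Num.Theory.
Import numFieldNormedType.Exports.
Local Open Scope classical_set_scope.
Local Open Scope ring_scope.

(* Unital (nonzero) C*-algebras over C = R[i].  The norm is an R-valued
   operation of its own: the only join of rings with normed groups in the
   library is that of the commutative numeric domains. *)
HB.mixin Record isCstar (R : realType) A of GRing.Algebra R[i] A := {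
  star : A -> A;
  nrm : A -> R;
  nrm_eq0 : forall a : A, nrm a = 0 -> a = 0;
  nrmZ : forall (k : R[i]) (a : A), nrm (k *: a) = complex.Re `|k| * nrm a;
  nrmD : forall a b : A, nrm (a + b) <= nrm a + nrm b;
  nrmM : forall a b : A, nrm (a * b) <= nrm a * nrm b;
  nrm_complete : forall u : nat -> A,
    (forall e, 0 < e -> exists N, forall m n, (N <= m)%N -> (N <= n)%N ->
       nrm (u m - u n) < e) ->
    exists l, forall e, 0 < e -> exists N, forall n, (N <= n)%N ->
       nrm (u n - l) < e;
  starK : involutive star;
  star_antilinear : forall (k : R[i]) (a b : A),
    star (k *: a + b) = k^* *: star a + star b;
  starM : forall a b : A, star (a * b) = star b * star a;
  cstar_identity : forall a : A, nrm (star a * a) = nrm a ^+ 2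
}.

#[short(type="cstarType")]
HB.structure Definition Cstar (R : realType) :=
  {A of GRing.Algebra R[i] A & isCstar R A}.

Section CstarNotions.
Variable R : realType.

Definition finite_dimensional (A : cstarType R) : Prop :=
  exists (n : nat) (b : 'I_n -> A),
    forall a, exists c : 'I_n -> R[i], a = \sum_(i < n) c i *: b i.

Definition star_morphism (A B : cstarType R) (f : A -> B) : Prop :=
  [/\ linear f, GRing.monoid_morphism f & forall a, f (star a) = star (f a)].

(* A positive linear functional of norm one; on a unital C*-algebra the norm
   of a positive functional is its value at 1. *)
Definition is_state (A : cstarType R) (phi : A -> R[i]) : Prop :=
  [/\ scalar phi,
      forall a, 0 <= phi (star a * a),
      forall a, complex.Re `|phi a| <= nrm a
    & phi 1 = 1].

Definition lin_span (A : lmodType R[i]) (S : set A) : set A :=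
  [set a | exists (n : nat) (c : 'I_n -> R[i]) (v : 'I_n -> A),
     (forall i, S (v i)) /\ a = \sum_(i < n) c i *: v i].

Definition norm_closure (A : cstarType R) (S : set A) : set A :=
  [set a | forall e : R, 0 < e -> exists b, S b /\ nrm (a - b) < e].

(* Continuity, for linear maps. *)
Definition bounded_map (A B : cstarType R) (f : A -> B) : Prop :=
  exists M : R, forall a, nrm (f a) <= M * nrm a.

Definition linear_on (A B : lmodType R[i]) (D : set A) (f : A -> B) : Prop :=
  forall (k : R[i]) (a b : A), D a -> D b -> f (k *: a + b) = k *: f a + f b.

Section SubalgebraMaps.
Variable A : cstarType R.

Definition commutant (C : set A) : set A :=
  [set a | forall c, C c -> a * c = c * a].

Definition mxstar n (X : 'M[A]_n) : 'M[A]_n := map_mx star X^T.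

(* Positivity in the C*-algebra M_n(D), for D a C*-subalgebra of A. *)
Definition mxpositive (D : set A) n (M : 'M[A]_n) : Prop :=
  exists X : 'M[A]_n, (forall i j, D (X i j)) /\ M = mxstar X *m X.

(* Maps between subalgebras D and B of A are represented by functions A -> A
   whose values outside D are irrelevant. *)
Definition completely_positive (D B : set A) (E : A -> A) : Prop :=
  forall n (M : 'M[A]_n), mxpositive D M -> mxpositive B (map_mx E M).

Definition transition_expectation (D B : set A) (E : A -> A) : Prop :=
  [/\ forall a, D a -> B (E a), linear_on D E, completely_positive D B E
    & E 1 = 1].

Definition Markov_transition_expectation (D B C : set A) (E : A -> A) : Prop :=
  transition_expectation D B E /\
  (forall a, commutant C a -> D a -> (commutant C `&` B) (E a)).

(* [F] is E (x) id on the algebra generated by the commuting subalgebras D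
   and D'; it is pinned down by boundedness when D D' spans a dense subspace. *)
Definition extends_by_identity (D D' : set A) (E F : A -> A) : Prop :=
  [/\ linear F, bounded_map F
    & forall a b, D a -> D' b -> F (a * b) = E a * b].

End SubalgebraMaps.

(* The observables are restricted to a set [L] of them, to be instantiated by
   the algebra of all local observables: on its completion, a pointwise
   convergent sequence of states is in general not eventually constant. *)
Definition strongly_finite_convergent (A : cstarType R) (L : set A)
    (phi_ : nat -> A -> R[i]) : Prop :=
  forall a, L a ->
    exists na : nat, forall n, (na <= n)%N -> phi_ n a = phi_ na a.

Definition strongly_finite_limit (A : cstarType R) (L : set A)
    (phi_ : nat -> A -> R[i]) (phi : A -> R[i]) : Prop :=
  forall a, L a -> exists na : nat, forall n, (na <= n)%N -> phi_ n a = phi a.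

(* A limit point of a sequence of functionals, for pointwise convergence. *)
Definition pointwise_limit_point (A : cstarType R)
    (phi_ : nat -> A -> R[i]) (phi : A -> R[i]) : Prop :=
  @cluster {ptws A -> R[i]^o} (phi_ @ \oo) phi.

Definition pointwise_limit (A : cstarType R)
    (phi_ : nat -> A -> R[i]) (phi : A -> R[i]) : Prop :=
  phi_ @ \oo --> (phi : {ptws A -> R[i]^o}).

End CstarNotions.

Section QuasiLocal.
Variables (R : realType) (V : choiceType) (Ax : V -> cstarType R).

(* [f a] depends only on the coordinates of [a] in [s], linearly in each. *)
Definition multilinear_in (W : lmodType R[i]) (s : seq V)
    (f : (forall x, Ax x) -> W) : Prop :=
  (forall a b : forall x, Ax x, (forall x, x \in s -> a x = b x) -> f a = f b)
  /\ (forall (a : forall x, Ax x) x, x \in s ->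
        linear (fun u : Ax x => f (dfwith a x u))).

Variables (A : cstarType R) (iota : forall x, Ax x -> A).

(* The image in A of the simple tensor of the [a x], x in [s]; under
   [quasi_local] below, the order of [s] does not matter. *)
Definition simple_tensor (s : seq V) (a : forall x, Ax x) : A :=
  \prod_(x <- s) iota (a x).

Definition tensor_alg (s : seq V) : set A :=
  lin_span (range (simple_tensor s)).

(* The union of the algebras of the finite subsets of L: for finite L it is
   the algebra of L itself, as simple tensors may have factors 1. *)
Definition local_alg (L : set V) : set A :=
  [set a | exists s : seq V, [/\ uniq s, [set` s] `<=` L & tensor_alg s a]].

Definition quasi_local_alg (L : set V) : set A := norm_closure (local_alg L).

(* A is the C*-inductive limit of the finite tensor products of the [Ax x],
   the [iota x] being the embeddings: over each finite set the subalgebra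
   spanned by simple tensors has the universal property of the tensor product,
   and these subalgebras have dense union.  No compatibility of norms has to
   be required: a finite-dimensional *-algebra has at most one C*-norm. *)
Record quasi_local : Prop := QuasiLocal {
  ql_morphism : forall x, star_morphism (@iota x);
  ql_commute : forall x y (a : Ax x) (b : Ax y), x != y ->
    iota a * iota b = iota b * iota a;
  ql_tensor : forall s : seq V, uniq s ->
    forall (W : lmodType R[i]) (f : (forall x, Ax x) -> W),
    multilinear_in s f ->
    exists g : A -> W, linear_on (tensor_alg s) g /\
                       forall a, g (simple_tensor s a) = f a;
  ql_dense : quasi_local_alg setT = setT
}.

Definition product_state (phix : forall x, Ax x -> R[i]) (phi0 : A -> R[i]) :=
  is_state phi0 /\
  forall (s : seq V) (a : forall x, Ax x), uniq s ->
    phi0 (simple_tensor s a) = \prod_(x <- s) phix x (a x).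

End QuasiLocal.

Section Tessellation.
Variables (V : choiceType) (adj : rel V).

Definition nbr (y : V) : set V := [set x | adj x y].

Definition simple_graph := symmetric adj /\ irreflexive adj.

Definition locally_finite := forall y, finite_set (nbr y).

Definition connected_graph :=
  forall x y, exists p : seq V, path adj x p /\ last x p = y.

Definition inner_bd (L : set V) : set V :=
  [set x | L x /\ exists y, ~ L y /\ adj x y].
Definition outer_bd (L : set V) : set V :=
  [set y | ~ L y /\ exists x, L x /\ adj x y].
Definition gclosure (L : set V) : set V := L `|` outer_bd L.

Variable y1 : V.

(* [V0 n] is V_{0,n}; V_{0,0} is empty, so that V_0 and its inner boundary
   are empty. *)
Fixpoint V0 (n : nat) : set V :=
  if n is m.+1 then
    if m is 0%N then [set y1] else V0 m `|` outer_bd (gclosure (V0 m))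
  else set0.

Definition Vn (n : nat) : set V := gclosure (V0 n).

(* The outer boundary of V_n, with the convention that it is {y1} at n = 0. *)
Definition level (n : nat) : set V :=
  if n is 0%N then [set y1] else outer_bd (Vn n).

Definition Vinf : set V := \bigcup_n V0 n.+1.

(* For y in [level n]. *)
Definition Np (n : nat) (y : V) : set V := nbr y `&` inner_bd (Vn n).
Definition Ns (n : nat) (y : V) : set V := nbr y `&` inner_bd (Vn n.+1).
Definition N0 (n : nat) (y : V) : set V := nbr y `\` (Np n y `|` Ns n y).

Definition star_at (y : V) : set V := y |` nbr y.

End Tessellation.

Section FieldSequence.
Variables (R : realType) (V : Type) (A : cstarType R).
Variables (enum : nat -> seq V) (Ebar : V -> A -> A) (phi0 : A -> R[i]).

(* E_{n,n+1}: the first element of the enumeration acts first. *)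
Definition level_map (n : nat) (a : A) : A :=
  foldl (fun b y => Ebar y b) a (enum n).

Fixpoint levels_map (n : nat) (a : A) : A :=
  if n is m.+1 then level_map n (levels_map m a) else level_map 0 a.

(* The functional is the restriction of the product state [phi0] to the range
   of [levels_map n], composed with [levels_map n]. *)
Definition phi_seq (n : nat) (a : A) : R[i] := phi0 (levels_map n a).

Definition forward_QMF (phi : A -> R[i]) : Prop :=
  pointwise_limit_point phi_seq phi.

End FieldSequence.

(* Main.v *)
Require Import Defs.
From HB Require Import structures.
From mathcomp Require Import all_boot all_order all_algebra.
From mathcomp Require Import complex.
From mathcomp Require Import all_classical all_reals all_analysis.
From mathcomp Require Import ring lra.
Set Implicit Arguments.
Unset Strict Implicit.
Unset Printing Implicit Defensive.
Import Order.TTheory GRing.Theory Num.Theory.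
Import numFieldNormedType.Exports.
Local Open Scope classical_set_scope.
Local Open Scope ring_scope.

(** Complete positivity makes [E (x) id] map sums of squares of local
    observables to such sums, so each [phi_n] is positive on the dense
    subalgebra of local observables, hence everywhere by boundedness; iterating
    the Cauchy-Schwarz inequality then makes it a contraction.  The maps of the
    levels up to [n] send observables localized in [V_(n+1)] to such
    observables, and the compatibility condition makes the next level map
    preserve the product state on them: on reaching a vertex [y] of the level
    [n+1], the current support meets the star of [y] only in its predecessors,
    because the successor sets of a level are disjoint from each other and from
    [V_(n+1)].  So [phi_n a] is eventually constant for local [a], and
    contractivity extends the convergence to the whole algebra. *)

(** * The modulus on [R[i]] as a real number *)

Local Notation cabs z := (complex.Re `|z|).

Section Modulus.
Variable R : realType.
Implicit Types z w : R[i].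

Lemma cabsE z : cabs z = Num.sqrt (complex.Re z ^+ 2 + complex.Im z ^+ 2).
Proof. by rewrite normc_def. Qed.

Lemma real_complex_cabs z : (cabs z)%:C%C = `|z|.
Proof. by rewrite RRe_real// normr_real. Qed.

Lemma cabs_ge0 z : 0 <= cabs z.
Proof. by rewrite cabsE sqrtr_ge0. Qed.

Lemma cabsM z w : cabs (z * w) = cabs z * cabs w.
Proof.
by apply: complexI; rewrite rmorphM/= !real_complex_cabs normrM.
Qed.

Lemma cabsD z w : cabs (z + w) <= cabs z + cabs w.
Proof. by rewrite -lecR rmorphD/= !real_complex_cabs ler_normD. Qed.

Lemma cabsN z : cabs (- z) = cabs z.
Proof. by rewrite normrN. Qed.

Lemma cabs_eq0 z : cabs z = 0 -> z = 0.
Proof.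
move=> z0; apply/eqP; rewrite -normr_eq0 -real_complex_cabs z0.
by rewrite eqxx.
Qed.

Lemma normr_Re_cabs z : `|complex.Re z| <= cabs z.
Proof. by rewrite cabsE -sqrtr_sqr ler_wsqrtr// lerDl sqr_ge0. Qed.

Lemma normr_Im_cabs z : `|complex.Im z| <= cabs z.
Proof. by rewrite cabsE -sqrtr_sqr ler_wsqrtr// lerDr sqr_ge0. Qed.

Lemma cabs_le_ReIm z : cabs z <= `|complex.Re z| + `|complex.Im z|.
Proof.
rewrite cabsE -[leRHS]ger0_norm ?addr_ge0// -sqrtr_sqr ler_wsqrtr//.
rewrite sqrrD !real_normK ?num_real// lerD2r lerDl.
by rewrite mulrn_wge0// mulr_ge0.
Qed.

(** The nonnegative half-line is closed: each of its points lies at distance at least [|Im z|] and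
    at least [- Re z] from [z]. *)
Lemma cabs_limit_ge0 z :
  (forall e : R, 0 < e -> exists w, 0 <= w /\ cabs (z - w) < e) -> 0 <= z.
Proof.
move=> h; rewrite lecE /=; apply/andP; split.
  apply/eqP/normr0_eq0/eqP; rewrite -[_ == _]negbK; apply/negP => z0.
  have [|w [w0 /le_lt_trans]] := h `|complex.Im z|.
    by rewrite lt0r z0 normr_ge0.
  move=> /(_ _ (normr_Im_cabs _)).
  case: z {h z0} => a b; case: w w0 => c d /=.
  by rewrite lecE/= => /andP[/eqP-> _]; rewrite subr0 ltxx.
rewrite leNgt; apply/negP => z0.
have [|w [w0 /le_lt_trans]] := h (- complex.Re z); first by rewrite oppr_gt0.
move=> /(_ _ (normr_Re_cabs _)).
case: z {h} z0 => a b; case: w w0 => c d /=.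
rewrite lecE/= => /andP[_ c0] a0; rewrite ler0_norm; last first.
  by rewrite subr_le0 (le_trans (ltW a0)).
by rewrite opprB ltNge lerDr c0.
Qed.

Lemma eq_cabs_lt z w : (forall e : R, 0 < e -> cabs (z - w) < e) -> z = w.
Proof.
move=> h; apply/eqP; rewrite -subr_eq0; apply/eqP/cabs_eq0/le_anti.
rewrite cabs_ge0 andbT leNgt; apply/negP => /h; by rewrite ltxx.
Qed.

End Modulus.

(** Repeated squaring washes out the constant [M]. If [x / y = 1 + t] with [t > 0], Bernoulli's
    inequality gives [m * t <= (1 + t) ^ (2 ^ m) <= M] for every [m], against the Archimedean
    property. *)
Lemma le_of_expn2_le (R : realType) (M x y : R) : 0 <= x -> 0 <= y ->
  (forall m, x ^+ (2 ^ m) <= M * y ^+ (2 ^ m)) -> x <= y.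
Proof.
move=> x0 y0 h; rewrite leNgt; apply/negP => yx.
have xgt0 : 0 < x by exact: le_lt_trans yx.
have [y00|yneq] := eqVneq y 0.
  by have := h 0%N; rewrite !expr1 y00 mulr0 leNgt xgt0.
have ygt0 : 0 < y by rewrite lt_neqAle eq_sym yneq.
pose t := x / y - 1.
have t0 : 0 < t by rewrite subr_gt0 ltr_pdivlMr// mul1r.
have bern n : 1 + n%:R * t <= (1 + t) ^+ n.
  elim: n => [|n IH]; first by rewrite mul0r addr0 expr0.
  rewrite exprS; apply: le_trans (ler_wpM2l _ IH); last by lra.
  rewrite -natr1.
  have : 0 <= n%:R * t * t :> R by rewrite !mulr_ge0// ltW.
  lra.
have le_n n : (n <= 2 ^ n)%N by apply/ltnW/ltn_expl.
have bnd m : m%:R * t <= M.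
  have := h m; rewrite -ler_pdivrMr ?exprn_gt0// -expr_div_n => hm.
  apply: le_trans hm; have -> : x / y = 1 + t by rewrite addrC subrK.
  apply: le_trans (bern _); rewrite ler_wpDl// (ler_wpM2r (ltW t0))//.
  by rewrite ler_nat.
have := bnd (Num.bound `|M / t|); rewrite leNgt => /negP; apply.
rewrite -ltr_pdivrMr//; apply: le_lt_trans (ler_norm _) _.
exact: archi_boundP.
Qed.

(** * Norm and involution of a C*-algebra *)

Section CstarBasics.
Variables (R : realType) (A : cstarType R).
Implicit Types a b : A.

Lemma nrm0 : nrm (0 : A) = 0.
Proof. by rewrite -(scale0r (0 : A)) nrmZ normr0 mul0r. Qed.

Lemma nrmN a : nrm (- a) = nrm a.
Proof. by rewrite -scaleN1r nrmZ normrN1 mul1r. Qed.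

Lemma nrm_ge0 a : 0 <= nrm a.
Proof.
have := nrmD a (- a); rewrite subrr nrm0 nrmN -mulr2n.
by rewrite pmulrn_lge0.
Qed.

Lemma starD a b : star (a + b) = star a + star b.
Proof. by rewrite -{1}(scale1r a) star_antilinear conjC1 scale1r. Qed.

Lemma star0 : star (0 : A) = 0.
Proof. by apply: (addrI (star 0)); rewrite -starD !addr0. Qed.

Lemma starB a b : star (a - b) = star a - star b.
Proof.
rewrite starD; congr (_ + _); apply: (addrI (star b)).
by rewrite -starD !subrr star0.
Qed.

Lemma starZ (k : R[i]) a : star (k *: a) = k^* *: star a.
Proof. by rewrite -[k *: a]addr0 star_antilinear star0 addr0. Qed.

Lemma star_sum (I : Type) (s : seq I) (F : I -> A) :
  star (\sum_(i <- s) F i) = \sum_(i <- s) star (F i).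
Proof. by apply: (big_morph star) => [a b|]; rewrite ?starD ?star0. Qed.

Lemma star1 : star (1 : A) = 1.
Proof. by rewrite -[LHS]mulr1 -{2}[1]starK -starM mulr1 starK. Qed.

(** The C*-identity and submultiplicativity give [nrm b ^ 2 <= nrm (star b) * nrm b]; cancel
    [nrm b], then exchange [b] and [star b]. *)
Lemma nrm_star a : nrm (star a) = nrm a.
Proof.
have le b : nrm b <= nrm (star b).
  have [b0|b0] := eqVneq (nrm b) 0; first by rewrite b0 nrm_ge0.
  have bgt : 0 < nrm b by rewrite lt_neqAle eq_sym b0 nrm_ge0.
  by rewrite -(ler_pM2r bgt) -expr2 -cstar_identity nrmM.
by apply: le_anti; rewrite le andbT -{2}[a]starK le.
Qed.

End CstarBasics.

(** * Positive functionals: Cauchy-Schwarz and contractivity *)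

Section BoundedPositive.
Variables (R : realType) (A : cstarType R) (phi : A -> R[i]).
Hypothesis phi_scalar : scalar phi.

Lemma scalarfD a b : phi (a + b) = phi a + phi b.
Proof. by rewrite -{1}[a]scale1r phi_scalar mul1r. Qed.

Lemma scalarf0 : phi 0 = 0.
Proof. by apply: (addrI (phi 0)); rewrite -scalarfD !addr0. Qed.

Lemma scalarfZ k a : phi (k *: a) = k * phi a.
Proof. by rewrite -[k *: a]addr0 phi_scalar scalarf0 addr0. Qed.

Lemma scalarfB a b : phi (a - b) = phi a - phi b.
Proof. by rewrite scalarfD -scaleN1r scalarfZ mulN1r. Qed.

Hypothesis phi_pos : forall a, 0 <= phi (star a * a).
Hypothesis phi1 : phi 1 = 1.

Lemma phi_sqr_shift a (k : R[i]) : phi (star (a + k *: 1) * (a + k *: 1)) =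
  phi (star a * a) + k * phi (star a) + k^* * phi a + k^* * k.
Proof.
rewrite starD starZ star1 mulrDl !mulrDr -!scalerAl -!scalerAr !mulr1 !mul1r.
by rewrite !scalarfD !scalarfZ phi1 mulr1 addrA.
Qed.

(** The expansion of [phi] on the square of [a + k] shows that [k * phi (star a) + k^* * phi a] is
    real for every [k]. Taking [k = 1] makes the imaginary parts opposite, [k = i] makes the real
    parts equal. *)
Lemma positive_star a : phi (star a) = (phi a)^*.
Proof.
have h k : complex.Im (k * phi (star a) + k^* * phi a) = 0.
  have := ger0_Im (phi_pos (a + k *: 1)); rewrite phi_sqr_shift.
  have := ger0_Im (phi_pos a).
  case: (phi (star a * a)) => p q /= ->; case: (phi a) => x y.
  case: (phi (star a)) => u v; case: k => c d /=; lra.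
have := h 1; have := h 'i%C; case: (phi a) => x y; case: (phi _) => u v /=.
by move=> h1 h2; apply/eqP; rewrite eq_complex /=; apply/andP; split;
  apply/eqP; lra.
Qed.

(** The shift [k = - phi a] minimizes [phi] on the square of [a + k], and the minimum is
    [phi (star a * a) - |phi a| ^ 2]. *)
Lemma positive_cauchy_schwarz a :
  cabs (phi a) ^+ 2 <= complex.Re (phi (star a * a)).
Proof.
have := phi_pos (a + (- phi a) *: 1); rewrite phi_sqr_shift positive_star.
rewrite cabsE (sqr_sqrtr (addr_ge0 (sqr_ge0 _) (sqr_ge0 _))) lecE => /andP[_].
by case: (phi (star a * a)) => p q; case: (phi a) => x y /=; lra.
Qed.

(** For self-adjoint [h], iterated Cauchy-Schwarz gives [|phi h| ^ (2 ^ m) <= |phi (h ^ (2 ^ m))| <=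
    M * nrm h ^ (2 ^ m)] for all [m], so the bound [M] can be replaced by 1. *)
Lemma state_of_bounded_positive (M : R) :
  (forall a, cabs (phi a) <= M * nrm a) -> is_state phi.
Proof.
move=> phi_bd; split => //.
have sa h : star h = h -> cabs (phi h) <= nrm h.
  move=> hh; apply: (@le_of_expn2_le _ M); [exact: cabs_ge0|exact: nrm_ge0|].
  have st m : star (h ^+ (2 ^ m)) = h ^+ (2 ^ m).
    by elim: m => [//|m IH]; rewrite expnS mulnC exprM expr2 starM IH.
  move=> m; apply: (@le_trans _ _ (cabs (phi (h ^+ (2 ^ m))))).
    elim: m => [|m IH]; first by rewrite !expr1.
    rewrite expnS mulnC !exprM.
    apply: (@le_trans _ _ (cabs (phi (h ^+ (2 ^ m))) ^+ 2)).
      by rewrite ler_sqr ?nnegrE ?exprn_ge0 ?cabs_ge0.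
    apply: le_trans (positive_cauchy_schwarz _) _.
    by rewrite st -expr2 (le_trans (ler_norm _))// normr_Re_cabs.
  apply: le_trans (phi_bd _) _.
  (* The bound at the unit gives the sign of [M], since [nrm 1 > 0] in a nonzero algebra. *)
  have M0 : 0 <= M.
    have n1 : 0 < nrm (1 : A).
      rewrite lt0r nrm_ge0 andbT; apply/eqP => /nrm_eq0 /eqP.
      by rewrite oner_eq0.
    by have := le_trans (cabs_ge0 _) (phi_bd 1); rewrite pmulr_lge0.
  rewrite ler_wpM2l//; elim: m => [|m IH]; first by rewrite !expr1.
  rewrite expnS mulnC !exprM expr2 (le_trans (nrmM _ _))// -expr2.
  by rewrite ler_sqr ?nnegrE ?exprn_ge0 ?nrm_ge0.
(* A general [a] reduces to the self-adjoint [star a * a]: [|phi a| ^ 2 <= phi (star a * a) <= nrm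
   (star a * a) = nrm a ^ 2]. *)
move=> a; rewrite -ler_sqr ?nnegrE ?cabs_ge0 ?nrm_ge0//.
rewrite -cstar_identity (le_trans (positive_cauchy_schwarz a))//.
rewrite (le_trans (ler_norm _))// (le_trans (normr_Re_cabs _))// sa//.
by rewrite starM starK.
Qed.

End BoundedPositive.

(** * Linear maps and linear spans *)

Section LinearMaps.
Variables (R : realType) (A B : lmodType R[i]) (f : A -> B).
Hypothesis f_linear : linear f.

Lemma linear_fun0 : f 0 = 0.
Proof. by have := f_linear (-1) 0 0; rewrite scaler0 addr0 scaleN1r addNr. Qed.

Lemma linear_funD a b : f (a + b) = f a + f b.
Proof. by rewrite -{1}[a]scale1r f_linear scale1r. Qed.

Lemma linear_fun_sum I (s : seq I) (G : I -> A) :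
  f (\sum_(i <- s) G i) = \sum_(i <- s) f (G i).
Proof. exact: (big_morph f linear_funD linear_fun0). Qed.

End LinearMaps.

Section LinSpan.
Variables (R : realType) (A : lmodType R[i]).
Implicit Types (S : set A).

Lemma lin_span0 S : lin_span S 0.
Proof. by exists 0%N, (fun=> 0), (fun=> 0); split=> [[]//|]; rewrite big_ord0. Qed.

Lemma lin_span_lin S k a b : lin_span S a -> lin_span S b ->
  lin_span S (k *: a + b).
Proof.
move=> [n [c [v [Sv ->]]]] [m [d [w [Sw ->]]]].
exists (n + m)%N,
  (fun i => match fintype.split i with inl j => k * c j | inr j => d j end),
  (fun i => match fintype.split i with inl j => v j | inr j => w j end).
split; first by move=> i; case: (fintype.split i).
rewrite big_split_ord/= scaler_sumr; congr (_ + _); apply: eq_bigr => i _.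
  by rewrite (unsplitK (inl i)) scalerA.
by rewrite (unsplitK (inr i)).
Qed.

Lemma sub_lin_span S a : S a -> lin_span S a.
Proof.
by move=> Sa; exists 1%N, (fun=> 1), (fun=> a); split=> //; rewrite big_ord1 scale1r.
Qed.

Lemma lin_span_ind S (P : A -> Prop) : P 0 ->
  (forall k t b, S t -> lin_span S b -> P b -> P (k *: t + b)) ->
  forall a, lin_span S a -> P a.
Proof.
move=> P0 PS a [n [c [v [Sv ->]]]].
elim: n c v Sv => [|n IH] c v Sv; first by rewrite big_ord0.
rewrite big_ord_recl; apply: PS => //; last by apply: IH.
by exists n, (c \o lift ord0), (v \o lift ord0); split=> [i|//]; exact: Sv.
Qed.

End LinSpan.

(** * Simple tensors, local algebras and the product state *)

Section LocalAlgebras.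
Variables (R : realType) (V : choiceType) (Ax : V -> cstarType R).
Variables (A : cstarType R) (iota : forall x, Ax x -> A).
Hypothesis iotaQ : quasi_local iota.

Local Notation st := (simple_tensor iota).
Local Notation la := (local_alg iota).

Lemma iota1 x : iota (1 : Ax x) = 1.
Proof. by have [_ [-> _] _] := ql_morphism iotaQ x. Qed.

Lemma iotaM x (a b : Ax x) : iota (a * b) = iota a * iota b.
Proof. by have [_ [_ ->] _] := ql_morphism iotaQ x. Qed.

Lemma iota_star x (a : Ax x) : iota (star a) = star (iota a).
Proof. by have [_ _ ->] := ql_morphism iotaQ x. Qed.

Lemma simple_tensor_cons x s a : st (x :: s) a = iota (a x) * st s a.
Proof. by rewrite /simple_tensor big_cons. Qed.

Lemma eq_simple_tensor s a b : (forall x, x \in s -> a x = b x) -> st s a = st s b.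
Proof. by move=> ab; apply: eq_big_seq => x /ab ->. Qed.

Lemma simple_tensor1 s : st s (fun=> 1) = 1.
Proof. by rewrite /simple_tensor big1// => x _; rewrite iota1. Qed.

Lemma iota_simple_tensorC x (u : Ax x) s a : x \notin s ->
  iota u * st s a = st s a * iota u.
Proof.
elim: s => [|y s IH]; first by rewrite /simple_tensor big_nil mulr1 mul1r.
rewrite inE negb_or simple_tensor_cons => /andP[xy xs].
by rewrite mulrA (ql_commute iotaQ)// -mulrA IH// mulrA.
Qed.

(** Factors at distinct sites commute, so those satisfying [P] can be moved to the front. *)
Lemma simple_tensor_split (P : pred V) s a : uniq s ->
  st s a = st (seq.filter P s) a * st (seq.filter (predC P) s) a.
Proof.
elim: s => [|x s IH]; first by rewrite /simple_tensor /= !big_nil mulr1.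
move=> /= /andP[xs us]; rewrite simple_tensor_cons IH//.
case: ifP => Px /=; rewrite simple_tensor_cons mulrA//.
by rewrite iota_simple_tensorC ?mem_filter ?Px// mulrA.
Qed.

Lemma perm_simple_tensor s t a : uniq s -> perm_eq s t -> st s a = st t a.
Proof.
elim: s t => [|x s IH] t.
  by move=> _; rewrite perm_sym => /perm_nilP ->.
move=> /= /andP[xs us] pst.
have ut : uniq t by rewrite -(perm_uniq pst) /= xs.
have xt : x \in t by rewrite -(perm_mem pst) mem_head.
(* Splitting [t] along the single site [x] brings the factor at [x] to the front. *)
rewrite simple_tensor_cons (simple_tensor_split (pred1 x) a ut).
rewrite filter_pred1_uniq// /simple_tensor big_seq1; congr (_ * _).
apply: IH => //; apply: uniq_perm => //; first exact: filter_uniq.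
move=> y; rewrite mem_filter -(perm_mem pst) !inE /=.
by have [->|] := eqVneq y x; first by rewrite (negbTE xs).
Qed.

Lemma extend_simple_tensor s t a : uniq s -> uniq t -> {subset s <= t} ->
  st s a = st t (fun x => if x \in s then a x else 1).
Proof.
move=> us ut sub; rewrite (simple_tensor_split (mem s) _ ut).
rewrite [X in _ = _ * X](_ : _ = 1).
  rewrite mulr1 (@perm_simple_tensor s (seq.filter (mem s) t) _ us).
    by apply: eq_simple_tensor => x; rewrite mem_filter => /andP[/= ->].
  apply: uniq_perm => //; first exact: filter_uniq.
  move=> x; rewrite mem_filter /=.
  by have [/sub ->|] := boolP (x \in s).
rewrite -[RHS](simple_tensor1 (seq.filter (predC (mem s)) t)).
by apply: eq_simple_tensor => x; rewrite mem_filter => /andP[/= /negbTE ->].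
Qed.

Lemma simple_tensor_mul_iota s a x (u : Ax x) : uniq s -> x \in s ->
  st s a * iota u = st s (dfwith a x (a x * u)).
Proof.
elim: s => [//|y s IH] /= /andP[ys us]; rewrite inE !simple_tensor_cons.
have [xy|xy] /= := eqVneq x y.
  subst y; move=> _; rewrite dfwithin iotaM -!mulrA; congr (_ * _).
  rewrite -iota_simple_tensorC//; congr (_ * _).
  apply: eq_simple_tensor => z zs; rewrite dfwithout//.
  by apply: contraNneq ys => ->.
by move=> xs; rewrite dfwithout// -mulrA IH.
Qed.

Lemma star_simple_tensor s a : uniq s -> star (st s a) = st s (fun x => star (a x)).
Proof.
elim: s => [_|x s IH]; first by rewrite /simple_tensor !big_nil star1.
move=> /= /andP[xs us]; rewrite !simple_tensor_cons starM IH// -iota_star.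
by rewrite iota_simple_tensorC.
Qed.

Lemma simple_tensor_cat s t a b : ~~ has (mem s) t ->
  st s a * st t b = st (s ++ t) (fun x => if x \in s then a x else b x).
Proof.
move=> st0; rewrite /simple_tensor big_cat /=; congr (_ * _).
  by apply: eq_big_seq => x ->.
apply: eq_big_seq => x xt; case: ifP => // xs.
by case/negP: st0; apply/hasP; exists x.
Qed.

(** The finite set of sites varies with the element, so tensors over different subsets of [L] can be
    multiplied without first fixing a common sequence. *)
Definition tensors (L : set V) : set A :=
  [set t | exists s a, [/\ uniq s, [set` s] `<=` L & t = st s a]].

Lemma tensors1 L : tensors L 1.
Proof.
exists [::], (fun=> 1); split=> //.
by rewrite simple_tensor1.
Qed.

Lemma tensors_mul_iota L t x (u : Ax x) : L x -> tensors L t ->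
  tensors L (t * iota u).
Proof.
move=> Lx [s [a [us sL ->]]]; have [xs|xs] := boolP (x \in s).
  by exists s, (dfwith a x (a x * u)); rewrite simple_tensor_mul_iota.
exists (x :: s), (dfwith a x u); split=> /=; first by rewrite xs.
  by move=> y /=; rewrite inE => /orP[/eqP->//|/sL].
rewrite simple_tensor_cons dfwithin -iota_simple_tensorC//; congr (_ * _).
apply: eq_simple_tensor => z zs; rewrite dfwithout//.
by apply: contraNneq xs => ->.
Qed.

Lemma tensorsM L t u : tensors L t -> tensors L u -> tensors L (t * u).
Proof.
move=> Lt [s [a [_ sL ->]]]; elim: s t Lt sL => [|x s IH] t Lt sL.
  by rewrite /simple_tensor big_nil mulr1.
rewrite simple_tensor_cons mulrA; apply: IH.
  by apply: tensors_mul_iota => //; apply: sL; rewrite /= mem_head.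
by move=> y /= ys; apply: sL; rewrite /= inE ys orbT.
Qed.

Lemma tensors_star L t : tensors L t -> tensors L (star t).
Proof.
move=> [s [a [us sL ->]]]; exists s, (fun x => star (a x)).
by rewrite star_simple_tensor.
Qed.

Lemma tensors_split (Q L : set V) t : tensors L t ->
  exists t1 t2, [/\ tensors (L `&` Q) t1, tensors (L `\` Q) t2 & t = t1 * t2].
Proof.
move=> [s [a [us sL ->]]]; pose P x := `[< Q x >].
exists (st (seq.filter P s) a), (st (seq.filter (predC P) s) a); split.
- exists (seq.filter P s), a; split=> //; first exact: filter_uniq.
  by move=> x /=; rewrite mem_filter => /andP[/asboolP Qx /sL].
- exists (seq.filter (predC P) s), a; split=> //; first exact: filter_uniq.
  by move=> x /=; rewrite mem_filter => /andP[/asboolP Qx /sL].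
exact: simple_tensor_split.
Qed.

(** This gives [local_alg] a fixed spanning set, which makes it a linear subspace and allows
    induction on its elements. *)
Lemma local_algE L : la L = lin_span (tensors L).
Proof.
apply/seteqP; split=> a.
  move=> [s [us sL]]; rewrite /tensor_alg => h.
  elim/lin_span_ind: h; first exact: lin_span0.
  move=> k t b [c _ <-] _ Sb; apply: lin_span_lin => //.
  by apply: sub_lin_span; exists s, c.
elim/lin_span_ind; first by exists [::]; split=> //; exact: lin_span0.
move=> k t b [s [c [us sL ->]]] _ [s' [us' sL' Sb]].
(* Two elements over different finite sets are compared over the union, padding by units. *)
pose u := undup (s ++ s').
have uu : uniq u by exact: undup_uniq.
exists u; split=> //.
  by move=> x; rewrite /= mem_undup mem_cat => /orP[/sL|/sL'].
apply: lin_span_lin.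
  apply: sub_lin_span; rewrite (@extend_simple_tensor s u)//.
  by move=> x xs; rewrite mem_undup mem_cat xs.
rewrite /tensor_alg; elim/lin_span_ind: Sb; first exact: lin_span0.
move=> k' t' b' [c' _ <-] _; apply: lin_span_lin.
apply: sub_lin_span; rewrite (@extend_simple_tensor s' u)//.
by move=> x xs; rewrite mem_undup mem_cat xs orbT.
Qed.

Lemma tensors_local_alg L t : tensors L t -> la L t.
Proof. by rewrite local_algE; exact: sub_lin_span. Qed.

Lemma local_alg_lin L k a b : la L a -> la L b -> la L (k *: a + b).
Proof. by rewrite local_algE; exact: lin_span_lin. Qed.

Lemma local_alg0 L : la L 0.
Proof. by rewrite local_algE; exact: lin_span0. Qed.

Lemma local_alg_ind L (P : A -> Prop) : P 0 ->
  (forall k t b, tensors L t -> la L b -> P b -> P (k *: t + b)) ->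
  forall a, la L a -> P a.
Proof. rewrite local_algE; exact: lin_span_ind. Qed.

Lemma local_alg1 L : la L 1.
Proof. exact/tensors_local_alg/tensors1. Qed.

Lemma local_algD L a b : la L a -> la L b -> la L (a + b).
Proof. by rewrite -{2}[a]scale1r; exact: local_alg_lin. Qed.

Lemma local_algZ L k a : la L a -> la L (k *: a).
Proof.
move=> La; rewrite -[_ *: _]addr0.
by apply: local_alg_lin => //; exact: local_alg0.
Qed.

Lemma local_alg_sum L I (s : seq I) (P : pred I) (G : I -> A) :
  (forall i, P i -> la L (G i)) -> la L (\sum_(i <- s | P i) G i).
Proof.
move=> h; apply: (big_ind (la L)) => //; [exact: local_alg0|].
by move=> a b; exact: local_algD.
Qed.

Lemma local_algM L a b : la L a -> la L b -> la L (a * b).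
Proof.
move=> La Lb; elim/local_alg_ind: a / La; first by rewrite mul0r; exact: local_alg0.
move=> k t a Lt La IH; rewrite mulrDl -scalerAl; apply: local_alg_lin => //.
elim/local_alg_ind: b / Lb {IH}; first by rewrite mulr0; exact: local_alg0.
move=> k' t' b Lt' Lb IH; rewrite mulrDr -scalerAr; apply: local_alg_lin => //.
by apply: tensors_local_alg; exact: tensorsM.
Qed.

Lemma local_alg_star L a : la L a -> la L (star a).
Proof.
elim/local_alg_ind; first by rewrite star0; exact: local_alg0.
move=> k t b Lt _ Lb; rewrite star_antilinear; apply: local_alg_lin => //.
by apply: tensors_local_alg; exact: tensors_star.
Qed.

Lemma local_alg_mono L L' : L `<=` L' -> la L `<=` la L'.
Proof.
move=> LL' a [s [us sL Sa]]; exists s; split=> //; exact: subset_trans LL'.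
Qed.

Lemma local_algC L L' a b : L `&` L' = set0 -> la L a -> la L' b -> a * b = b * a.
Proof.
move=> LL' La Lb; elim/local_alg_ind: a / La; first by rewrite mul0r mulr0.
move=> k t a [s [c [us sL ->]]] La IH; rewrite mulrDl mulrDr -scalerAl -scalerAr IH.
congr (_ *: _ + _); move: Lb; elim/local_alg_ind; first by rewrite mul0r mulr0.
move=> k' t' {IH}b [s' [d [us' sL' ->]]] Lb IH.
rewrite mulrDl mulrDr -scalerAl -scalerAr IH; congr (_ *: _ + _).
elim: s us sL {IH} => [|x s IH]; first by rewrite /simple_tensor big_nil mulr1 mul1r.
move=> /= /andP[xs us] sL; rewrite simple_tensor_cons -mulrA IH//; last first.
  by move=> y /= ys; apply: sL; rewrite /= inE ys orbT.
rewrite !mulrA iota_simple_tensorC//; apply/negP => xs'.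
suff : (L `&` L') x by rewrite LL'.
by split; [apply: sL; rewrite /= mem_head|exact: sL'].
Qed.

Lemma sub_quasi_local_alg L : la L `<=` quasi_local_alg iota L.
Proof. by move=> a La e e0; exists a; rewrite subrr nrm0. Qed.

Variables (phix : forall x, Ax x -> R[i]) (phi0 : A -> R[i]).
Hypothesis phi0P : product_state iota phix phi0.

Lemma product_state_scalar : scalar phi0.
Proof. by have [[]] := phi0P. Qed.

(** On simple tensors, disjointness keeps the concatenated sequence of sites free of repetitions, so
    the product formula applies to it; bilinearity does the rest. *)
Lemma product_stateM L L' a b : L `&` L' = set0 -> la L a -> la L' b ->
  phi0 (a * b) = phi0 a * phi0 b.
Proof.
have lin := product_state_scalar; have phi00 := scalarf0 lin.
move=> LL' La Lb; elim/local_alg_ind: a / La; first by rewrite mul0r phi00 mul0r.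
move=> k t a [s [c [us sL ->]]] La IH; rewrite mulrDl -scalerAl !lin IH mulrDl -mulrA.
congr (_ * _ + _); move: Lb; elim/local_alg_ind; first by rewrite mulr0 phi00 mulr0.
move=> k' t' {IH}b [s' [d [us' sL' ->]]] Lb IH.
rewrite mulrDr -scalerAr !lin IH mulrDr mulrCA; congr (_ * _ + _).
have ss' : ~~ has (mem s) s'.
  apply/hasPn => x xs'; apply/negP => /= xs.
  suff : (L `&` L') x by rewrite LL'.
  by split; [exact: sL|exact: sL'].
rewrite simple_tensor_cat//.
have [_ phi0E] := phi0P; rewrite !phi0E// ?cat_uniq ?us ?us' ?ss'//.
rewrite big_cat/=; congr (_ * _); apply: eq_big_seq => x xs; first by rewrite xs.
case: ifP => // xs'.
by case/negP: ss'; apply/hasP; exists x.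
Qed.

End LocalAlgebras.

(** * Extending a transition expectation by the identity *)

Section IdentityExtension.
Variables (R : realType) (V : choiceType) (Ax : V -> cstarType R).
Variables (A : cstarType R) (iota : forall x, Ax x -> A).
Hypothesis iotaQ : quasi_local iota.
Local Notation la := (local_alg iota).

(** Positivity is tracked through explicit local square roots: the extension is known by a formula
    only on local elements, and a positive functional is visibly nonnegative on such sums. *)
Definition sum_of_squares (a : A) : Prop := exists s : seq A,
  (forall d, d \in s -> la setT d) /\ a = \sum_(d <- s) star d * d.

Lemma sum_of_squares_square a : la setT a -> sum_of_squares (star a * a).
Proof.
by move=> La; exists [:: a]; split=> [d|]; rewrite ?big_seq1// inE => /eqP ->.
Qed.

Lemma sum_of_squares_sum I (s : seq I) (P : pred I) (G : I -> A) :
  (forall i, P i -> sum_of_squares (G i)) ->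
  sum_of_squares (\sum_(i <- s | P i) G i).
Proof.
move=> h; apply: (big_ind sum_of_squares) => //.
  by exists [::]; rewrite big_nil.
move=> a b [u [Lu ->]] [v [Lv ->]]; exists (u ++ v); rewrite big_cat; split=> // d.
by rewrite mem_cat => /orP[/Lu|/Lv].
Qed.

Variables (S T : set V) (E F : A -> A).
Hypothesis TS : T `<=` S.
Hypothesis E_texp : transition_expectation (la S) (la T) E.
Hypothesis F_ext : extends_by_identity (la S) (quasi_local_alg iota (~` S)) E F.

Let F_linear : linear F. Proof. by have [] := F_ext. Qed.

Let F_mul a b : la S a -> la (~` S) b -> F (a * b) = E a * b.
Proof. by have [_ _ h] := F_ext => Sa Sb; apply: h => //; exact: sub_quasi_local_alg. Qed.

Lemma extension1 : F 1 = 1.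
Proof.
rewrite -(mulr1 (1 : A)) F_mul; try exact: local_alg1.
by have [_ _ _ ->] := E_texp; rewrite mulr1.
Qed.

(** A simple tensor factors along [S]: [E] acts on the part inside [S] and the part outside passes
    through. *)
Lemma extension_tensors U t : tensors iota U t ->
  exists t1 t2, [/\ la (U `&` S) t1, la (U `\` S) t2, t = t1 * t2 & F t = E t1 * t2].
Proof.
move=> /(tensors_split iotaQ S)[t1 [t2 [/(tensors_local_alg iotaQ) Ut1
  /(tensors_local_alg iotaQ) Ut2 ->]]].
exists t1, t2; split=> //; apply: F_mul.
  by move: Ut1; apply: local_alg_mono => x [].
by move: Ut2; apply: local_alg_mono => x [].
Qed.

Lemma extension_local_alg U a : la U a -> la (U `|` T) (F a).
Proof.
elim/(local_alg_ind iotaQ) => [|k t b Ut _ IH].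
  by rewrite linear_fun0//; exact: local_alg0.
rewrite F_linear; apply: local_alg_lin => //.
have [t1 [t2 [Ut1 Ut2 _ ->]]] := extension_tensors Ut.
apply: local_algM => //; last by move: Ut2; apply: local_alg_mono => x [] ? _; left.
have [ET _ _ _] := E_texp.
suff : la T (E t1) by apply: local_alg_mono => x; right.
by apply: ET; move: Ut1; apply: local_alg_mono => x [].
Qed.

(** Write a tensor as [t1 * t2], split along [S]. Since [T] lies in [S], both [t1] and [E t1] have
    support disjoint from that of [t2], so [phi0] factors before and after [F]; the factors at [t1]
    agree because [t1] is localized in [P]. *)
Lemma extension_product_state phix phi0 (P U : set V) a :
  product_state iota phix phi0 -> U `&` T = set0 -> U `&` S `<=` P ->
  (forall b, la P b -> phi0 (E b) = phi0 b) ->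
  la U a -> phi0 (F a) = phi0 a.
Proof.
move=> phi0P UT USP phi0E.
have lin := product_state_scalar phi0P.
elim/(local_alg_ind iotaQ) => [|k t b Ut _ IH]; first by rewrite linear_fun0.
rewrite F_linear !lin IH; congr (_ * _ + _).
have [t1 [t2 [Ut1 Ut2 -> ->]]] := extension_tensors Ut.
have [ET _ _ _] := E_texp.
have TU2 : T `&` (U `\` S) = set0.
  by apply/seteqP; split=> // x [/TS ? []].
have U12 : (U `&` S) `&` (U `\` S) = set0.
  by apply/seteqP; split=> // x [[_ ?] []].
have Et1 : la T (E t1) by apply: ET; move: Ut1; apply: local_alg_mono => x [].
rewrite (product_stateM iotaQ phi0P TU2 Et1 Ut2).
rewrite (product_stateM iotaQ phi0P U12 Ut1 Ut2) phi0E//.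
by move: Ut1; apply: local_alg_mono.
Qed.

Lemma local_alg_split a : la setT a -> exists s : seq (A * A),
  (forall p, p \in s -> la S p.1 /\ la (~` S) p.2) /\ a = \sum_(p <- s) p.1 * p.2.
Proof.
elim/(local_alg_ind iotaQ) => [|k t b Ut _ [s [Ls ->]]].
  by exists [::]; rewrite big_nil.
have [t1 [t2 [/(tensors_local_alg iotaQ) L1 /(tensors_local_alg iotaQ) L2 ->]]] :=
  tensors_split iotaQ S Ut.
exists ((k *: t1, t2) :: s); rewrite big_cons scalerAl; split=> // p.
rewrite inE => /orP[/eqP ->/=|/Ls//]; split.
  by apply: local_algZ => //; move: L1; apply: local_alg_mono => x [].
by move: L2; apply: local_alg_mono => x [].
Qed.

(* Complete positivity enters through the matrix [star a_i * a_j], which is the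
   square of the matrix with first row [a] and other rows 0. *)
Lemma expectation_gram n (a : 'I_n -> A) : (forall i, la S (a i)) ->
  exists Y : 'M[A]_n, (forall i j, la T (Y i j)) /\
    forall i j, E (star (a i) * a j) = \sum_k star (Y k i) * Y k j.
Proof.
move=> Sa; have [_ _ CP _] := E_texp.
have [|Y [TY EY]] := CP n (\matrix_(i, j) (star (a i) * a j)).
  exists (\matrix_(i, j) if val i == 0%N then a j else 0); split.
    by move=> i j; rewrite mxE; case: ifP => // _; exact: local_alg0.
  apply/matrixP => i j; rewrite !mxE; case: n a Sa i j => [a _ []//|n] a _ i j.
  rewrite big_ord_recl !mxE /= big1 ?addr0// => k _.
  by rewrite !mxE /= star0 mul0r.
exists Y; split=> // i j; have := congr1 (fun M : 'M[A]_n => M i j) EY.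
by rewrite !mxE => ->; apply: eq_bigr => k _; rewrite !mxE.
Qed.

(** With [c] the sum of the [a i * b i], commutation gives [star c * c] as the sum of
    [(star (a i) * a j) * (star (b i) * b j)]. The Gram matrix [Y] of the images under [E] turns its
    image into the sum over [k] of the squares of [\sum_i Y k i * b i]. *)
Lemma extension_square c : la setT c -> sum_of_squares (F (star c * c)).
Proof.
move=> /local_alg_split[s [Ls ->]].
have Sx (x : A) : la S x -> la setT x by apply: local_alg_mono.
have Cx (x : A) : la (~` S) x -> la setT x by apply: local_alg_mono.
have comm x y : la S x -> la (~` S) y -> x * y = y * x.
  by apply: local_algC => //; exact: setICr.
rewrite big_tnth; set n := size s.
pose a i := (tnth (in_tuple s) i).1; pose b i := (tnth (in_tuple s) i).2.
have La i : la S (a i) by have [] := Ls _ (mem_tnth i (in_tuple s)).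
have Lb i : la (~` S) (b i) by have [] := Ls _ (mem_tnth i (in_tuple s)).
rewrite (eq_bigr (fun i => a i * b i))//.
have [Y [TY EY]] := expectation_gram La.
have SY i j : la S (Y i j) by move: (TY i j); apply: local_alg_mono.
suff -> : F (star (\sum_i a i * b i) * \sum_i a i * b i) =
    \sum_k star (\sum_i Y k i * b i) * \sum_i Y k i * b i.
  apply: sum_of_squares_sum => k _; apply: sum_of_squares_square.
  by apply: local_alg_sum => // i _; apply: local_algM => //; [exact: Sx|exact: Cx].
have sq (x : 'I_n -> A) : (forall i, la S (x i)) ->
  star (\sum_i x i * b i) * (\sum_i x i * b i) =
  \sum_i \sum_j (star (x i) * x j) * (star (b i) * b j).
  move=> Lx; rewrite star_sum mulr_suml; apply: eq_bigr => i _.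
  rewrite mulr_sumr; apply: eq_bigr => j _; rewrite starM -[LHS]mulrA.
  rewrite [star (x i) * (x j * b j)]mulrA mulrA.
  rewrite -(comm (star (x i) * x j) (star (b i))) ?mulrA//.
    by apply: local_algM => //; exact: local_alg_star.
  exact: local_alg_star.
rewrite sq// linear_fun_sum//.
under [RHS]eq_bigr do rewrite sq//.
rewrite [RHS]exchange_big/=; apply: eq_bigr => i _.
rewrite linear_fun_sum// [RHS]exchange_big/=; apply: eq_bigr => j _.
rewrite F_mul; first by rewrite EY mulr_suml.
  by apply: local_algM => //; apply: local_alg_star.
by apply: local_algM => //; apply: local_alg_star.
Qed.

Lemma extension_sum_of_squares c : sum_of_squares c -> sum_of_squares (F c).
Proof.
move=> [s [Ls ->]]; rewrite linear_fun_sum// big_seq.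
by apply: sum_of_squares_sum => d /Ls; exact: extension_square.
Qed.

End IdentityExtension.

(** * Geometry of the tessellation *)

Section TessellationFacts.
Variables (V : choiceType) (adj : rel V) (y1 : V).
Local Notation V0 := (V0 adj y1).
Local Notation Vn := (Vn adj y1).
Local Notation level := (level adj y1).
Local Notation Ns := (Ns adj y1).
Local Notation Np := (Np adj y1).

Lemma level_sub_V0 n : level n `<=` V0 n.+1.
Proof. by case: n => [//|n] x; right. Qed.

Lemma level_sub_Vinf n : level n `<=` Vinf adj y1.
Proof. by move=> x /level_sub_V0; exists n. Qed.

Lemma V0S n : V0 n `<=` V0 n.+1.
Proof. by case: n => [x []|n x]; left. Qed.

Lemma V0_sub_Vn n : V0 n `<=` Vn n.
Proof. by move=> x; left. Qed.

Lemma V0_adj n x y : V0 n x -> adj x y -> Vn n y.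
Proof.
move=> V0x xy; have [|V0y] := pselect (V0 n y); first exact: V0_sub_Vn.
by right; split=> //; exists x.
Qed.

Lemma VnS n : Vn n `<=` Vn n.+1.
Proof.
by move=> x [/V0S/V0_sub_Vn//|[_ [y [/V0S]]]]; exact: V0_adj.
Qed.

Lemma sub_Vn m n : (m <= n)%N -> Vn m `<=` Vn n.
Proof.
move=> /subnK <-; elim: (n - m)%N => [//|k IH].
by apply: subset_trans IH _; exact: VnS.
Qed.

Lemma Vn0 x : ~ Vn 0 x.
Proof. by case=> [[]|[_ [y []]]]. Qed.

Lemma Vn_adj n x y : Vn n x -> adj x y -> Vn n.+1 y.
Proof.
move=> Vx xy; have [|Vy] := pselect (Vn n y); first exact: VnS.
(* At [n = 0] there is no such [x], as [V_0] is empty; for positive index the outer boundary of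
   [V_n] is part of [V_{0,n+1}]. *)
case: n Vx Vy => [/Vn0//|n] Vx Vy.
by apply/V0_sub_Vn/level_sub_V0; split=> //; exists x.
Qed.

Lemma level_notin_Vn n x : level n x -> ~ Vn n x.
Proof. by case: n => [_|n []//]; exact: Vn0. Qed.

Lemma Ns_sub_Vn n y : Ns n y `<=` Vn n.+1.
Proof. by move=> x [_ []]. Qed.

(** A successor lies in the inner boundary of [V_(n+1)], so it has a neighbour outside [V_(n+1)],
    whereas all neighbours of [V_n] are inside. *)
Lemma Ns_notin_Vn n y x : Ns n y x -> ~ Vn n x.
Proof. by move=> [_ [_ [z [Vz xz]]]] /Vn_adj/(_ xz). Qed.

(** A vertex of the level belongs to [V_{0,n+1}], so all its neighbours are in [V_(n+1)]; a
    successor has one outside. *)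
Lemma Ns_notin_level n y x : Ns n y x -> ~ level n x.
Proof. by move=> [_ [_ [z [Vz xz]]]] /level_sub_V0/V0_adj/(_ xz). Qed.

Lemma Ns_sub_star n y : Ns n y `<=` star_at adj y.
Proof. by move=> x [? _]; right. Qed.

Lemma star_at_sub n y : N0 adj y1 n y = set0 ->
  star_at adj y `<=` y |` (Np n y `|` Ns n y).
Proof.
move=> h x [->|yx]; [by left|right; apply: contrapT => ps].
by suff : N0 adj y1 n y x by rewrite h.
Qed.

Hypothesis adj_conn : connected_graph adj.

(** The root lies in [V_1], and each edge of a path raises the index by at most one. *)
Lemma exists_Vn x : exists n, Vn n x.
Proof.
have [p [yp <-]] := adj_conn y1 x.
suff h w : path adj w p -> (exists n, Vn n w) -> exists n, Vn n (last w p).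
  by apply: h => //; exists 1%N; left.
elim: p {yp} w => [//|z p IH] w /= /andP[wz zp] [n Vw].
by apply: IH => //; exists n.+1; exact: Vn_adj wz.
Qed.

Lemma exists_Vn_sub (s : seq V) : exists n, [set` s] `<=` Vn n.
Proof.
elim: s => [|x s [n sn]]; first by exists 0%N.
have [m xm] := exists_Vn x; exists (maxn m n) => y /=; rewrite inE => /orP[/eqP ->|ys].
  by move: xm; apply: sub_Vn; exact: leq_maxl.
by apply: (@sub_Vn n); [exact: leq_maxr|exact: sn].
Qed.

End TessellationFacts.

(** * Limits of states that stabilize on a dense set *)

Section Limits.
Variable R : realType.

Lemma real_cauchy_lim (u : nat -> R) :
  (forall e, 0 < e -> exists N, forall m n, (N <= m)%N -> (N <= n)%N ->
     `|u m - u n| < e) ->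
  exists l, forall e, 0 < e -> exists N, forall n, (N <= n)%N -> `|u n - l| < e.
Proof.
move=> h; have /cauchy_cvgP cu : cauchy (u @ \oo).
  apply: cauchy_exP => e e0; have [N hN] := h e e0.
  exists (u N), N => // n /= Nn; exact: hN.
exists (lim (u @ \oo)) => e e0.
move: cu => /cvgrPdist_lt/(_ e e0)[N _ hN].
by exists N => n Nn; rewrite distrC; exact: hN.
Qed.

Lemma complex_cauchy_lim (u : nat -> R[i]) :
  (forall e : R, 0 < e -> exists N, forall m n, (N <= m)%N -> (N <= n)%N ->
     cabs (u m - u n) < e) ->
  exists l, forall e : R, 0 < e -> exists N, forall n, (N <= n)%N -> cabs (u n - l) < e.
Proof.
move=> h.
have [|x hx] := @real_cauchy_lim (fun n => complex.Re (u n)).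
  move=> e /h[N hN]; exists N => m n Nm Nn; apply: le_lt_trans (hN m n Nm Nn).
  by rewrite -raddfB; exact: normr_Re_cabs.
have [|y hy] := @real_cauchy_lim (fun n => complex.Im (u n)).
  move=> e /h[N hN]; exists N => m n Nm Nn; apply: le_lt_trans (hN m n Nm Nn).
  by rewrite -raddfB; exact: normr_Im_cabs.
exists (x +i* y)%C => e e0; have e2 : 0 < e / 2 by lra.
have [N1 h1] := hx _ e2; have [N2 h2] := hy _ e2.
exists (maxn N1 N2) => n; rewrite geq_max => /andP[n1 n2].
have := h1 n n1; have := h2 n n2; have := cabs_le_ReIm (u n - (x +i* y)%C).
case: (u n) => a b; set z := cabs _; move: z => z /=; lra.
Qed.

Variables (A : cstarType R) (L : set A) (phi_ : nat -> A -> R[i]).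
Hypothesis L_dense : norm_closure L = setT.

Lemma eq_states_dense (phi psi : A -> R[i]) : is_state phi -> is_state psi ->
  (forall a, L a -> phi a = psi a) -> phi = psi.
Proof.
move=> [phi_lin _ phi_bd _] [psi_lin _ psi_bd _] eqL; apply/funext => a.
apply: eq_cabs_lt => e e0.
have : norm_closure L a by rewrite L_dense.
have e2 : 0 < e / 2 by lra.
move=> /(_ _ e2)[b [Lb ab]].
have -> : phi a - psi a = phi (a - b) - psi (a - b).
  by rewrite !scalarfB// (eqL b Lb); ring.
apply: le_lt_trans (cabsD _ _) _; rewrite cabsN.
have := phi_bd (a - b); have := psi_bd (a - b); lra.
Qed.

Hypothesis phi_state : forall n, is_state (phi_ n).
Hypothesis phi_sfc : strongly_finite_convergent L phi_.

(** Approximate [a] by [b] in [L]: late terms agree at [b], and states are contractions, so they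
    differ at [a] by at most [2 * nrm (a - b)]. *)
Lemma strongly_finite_cauchy a (e : R) : 0 < e ->
  exists N, forall m n, (N <= m)%N -> (N <= n)%N -> cabs (phi_ m a - phi_ n a) < e.
Proof.
move=> e0; have : norm_closure L a by rewrite L_dense.
have e2 : 0 < e / 2 by lra.
move=> /(_ _ e2)[b [Lb ab]]; have [N hN] := phi_sfc Lb.
exists N => m n Nm Nn.
have [m_lin _ m_bd _] := phi_state m; have [n_lin _ n_bd _] := phi_state n.
have -> : phi_ m a - phi_ n a = phi_ m (a - b) - phi_ n (a - b).
  by rewrite !scalarfB// hN// [phi_ n b]hN//; ring.
apply: le_lt_trans (cabsD _ _) _; rewrite cabsN.
have := m_bd (a - b); have := n_bd (a - b); lra.
Qed.

(** Each condition defining a state is closed under pointwise limits. *)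
Lemma state_limit phi :
  (forall a (e : R), 0 < e -> exists N, forall n, (N <= n)%N ->
     cabs (phi_ n a - phi a) < e) ->
  is_state phi.
Proof.
move=> hphi; split.
- move=> k a b; apply: eq_cabs_lt => e e0.
  (* The errors at [k *: a + b], [a] and [b] contribute [e'], [|k| * e'] and [e']. *)
  pose e' := e / (cabs k + 2).
  have k0 := cabs_ge0 k.
  have e'0 : 0 < e' by rewrite divr_gt0// ltr_wpDl.
  have [N1 h1] := hphi (k *: a + b) _ e'0.
  have [N2 h2] := hphi a _ e'0; have [N3 h3] := hphi b _ e'0.
  pose n := maxn N1 (maxn N2 N3).
  have := h1 n (leq_maxl _ _).
  have /h2 : (N2 <= n)%N by rewrite leq_max leq_maxl orbT.
  have /h3 : (N3 <= n)%N by rewrite !leq_max leqnn !orbT.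
  move=> l3 l2 l1; have [lin _ _ _] := phi_state n.
  rewrite (_ : _ - _ = - (phi_ n (k *: a + b) - phi (k *: a + b)) +
    (k * (phi_ n a - phi a) + (phi_ n b - phi b))); last by rewrite lin; ring.
  apply: le_lt_trans (cabsD _ _) _; rewrite cabsN.
  apply: (@lt_le_trans _ _ (e' + (cabs k * e' + e'))).
    apply: ltr_leD => //; apply: le_trans (cabsD _ _) _.
    by rewrite cabsM lerD ?(ltW l3)// ler_wpM2l// ltW.
  have : e' * (cabs k + 2) = e by rewrite divfK// gt_eqF// ltr_wpDl.
  by lra.
- move=> a; apply: cabs_limit_ge0 => e e0; have [N hN] := hphi (star a * a) e e0.
  exists (phi_ N (star a * a)); have [_ pos _ _] := phi_state N.
  by split=> //; rewrite -cabsN opprB hN.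
- move=> a; apply/ler_addgt0Pr => e e0; have [N hN] := hphi a e e0.
  have [_ _ bd _] := phi_state N.
  have := cabsD (phi_ N a) (- (phi_ N a - phi a)); rewrite cabsN subKr.
  have := bd a; have := hN N (leqnn _); lra.
- apply: eq_cabs_lt => e e0; have [N hN] := hphi 1 e e0.
  by have [_ _ _ <-] := phi_state N; rewrite -cabsN opprB hN.
Qed.

Lemma ptws_cvgP (phi : A -> R[i]) :
  (forall a (e : R), 0 < e -> exists N, forall n, (N <= n)%N ->
     cabs (phi_ n a - phi a) < e) ->
  pointwise_limit phi_ phi.
Proof.
(* The product topology is the supremum of those pulled back by evaluations, so convergence is
   checked at one [a] at a time. *)
move=> hphi; apply/cvg_sup => a Q; rewrite nbhsE => -[B [[C oC <-] Cphi] CQ].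
apply: filterS CQ _.
suff : (phi_ n a : R[i]^o) @[n --> \oo] --> (phi a : R[i]^o).
  by apply; exact: open_nbhs_nbhs.
apply/cvgrPdist_lt => e e0.
(* The radius [e] is a positive element of [R[i]], hence real and equal to its real part. *)
have [N hN] : exists N, forall n, (N <= n)%N -> cabs (phi_ n a - phi a) < complex.Re e.
  by apply: hphi; move: e0; rewrite ltcE => /andP[].
exists N => // n /= /hN; rewrite distrC => lt.
rewrite -real_complex_cabs ltcE /=; apply/andP; split=> //.
by move: e0; rewrite ltcE => /andP[].
Qed.

(** A product of Hausdorff spaces is Hausdorff, so a convergent sequence clusters only at its
    limit. *)
Lemma pointwise_limit_point_unique (phi : A -> R[i]) :
  pointwise_limit phi_ phi -> unique (pointwise_limit_point phi_) phi.
Proof.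
move=> lim; split.
  move=> B C FB nC; have FC := lim _ nC.
  exact: filter_ex (filterI FB FC).
move=> psi cl.
have hd : hausdorff_space {ptws A -> R[i]^o}.
  by apply: hausdorff_product => a; exact: norm_hausdorff.
by apply: hd => B C nB nC; apply: cl => //; exact: lim.
Qed.

Lemma strongly_finite_convergence : exists phi : A -> R[i],
  [/\ unique (pointwise_limit_point phi_) phi,
      unique (fun psi => is_state psi /\ strongly_finite_limit L phi_ psi) phi
    & pointwise_limit phi_ phi].
Proof.
have [phi hphi] := choice (fun a => complex_cauchy_lim (@strongly_finite_cauchy a)).
have lim := ptws_cvgP hphi; have st := state_limit hphi.
exists phi; split=> //; first exact: pointwise_limit_point_unique.
have sf : strongly_finite_limit L phi_ phi.
  move=> a La; have [N hN] := phi_sfc La; exists N => n Nn.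
  apply: eq_cabs_lt => e e0; have [M hM] := hphi a e e0.
  rewrite hN// -[phi_ N a](hN (maxn N M)) ?leq_maxl//.
  by apply: hM; exact: leq_maxr.
split=> // psi [psi_st psi_lim]; apply: eq_states_dense => // a La.
have [N hN] := sf _ La; have [M hM] := psi_lim _ La.
by rewrite -(hN (maxn N M)) ?leq_maxl// hM// leq_maxr.
Qed.

End Limits.

(** * Maps that pull states back to states *)

Section SquarePreservingMaps.
Variables (R : realType) (V : choiceType) (Ax : V -> cstarType R).
Variables (A : cstarType R) (iota : forall x, Ax x -> A).
Hypothesis iotaQ : quasi_local iota.
Local Notation la := (local_alg iota).

(** These properties are stable under composition and suffice for [phi0 \o F] to be a state;
    boundedness carries positivity from local elements to their closure. *)
Definition square_preserving (F : A -> A) : Prop :=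
  [/\ linear F, bounded_map F, F 1 = 1
    & forall c, sum_of_squares iota c -> sum_of_squares iota (F c)].

Lemma square_preserving_id : square_preserving id.
Proof. by split=> //; exists 1 => a; rewrite mul1r. Qed.

Lemma square_preserving_comp F G : square_preserving F -> square_preserving G ->
  square_preserving (F \o G).
Proof.
move=> [F_lin [M FM] F1 FS] [G_lin [N GN] G1 GS]; split=> /=.
- by move=> k a b /=; rewrite G_lin F_lin.
- exists (`|M| * N) => a /=; apply: le_trans (FM _) _.
  apply: (@le_trans _ _ (`|M| * nrm (G a))).
    by rewrite ler_wpM2r ?nrm_ge0// ler_norm.
  by rewrite -mulrA ler_wpM2l.
- by rewrite G1.
- by move=> c /GS/FS.
Qed.

Lemma square_preserving_foldl (I : eqType) (F : I -> A -> A) (s : seq I) :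
  (forall i, i \in s -> square_preserving (F i)) ->
  square_preserving (fun a => foldl (fun b i => F i b) a s).
Proof.
elim: s => [_|i s IH sF]; first exact: square_preserving_id.
apply: (@square_preserving_comp (fun a => foldl (fun b j => F j b) a s) (F i)).
  by apply: IH => j js; apply: sF; rewrite inE js orbT.
by apply: sF; rewrite mem_head.
Qed.

Lemma square_preserving_state (phi0 : A -> R[i]) (F : A -> A) : is_state phi0 ->
  square_preserving F -> is_state (phi0 \o F).
Proof.
move=> [phi_lin phi_pos phi_bd phi1] [F_lin [M FM] F1 FS].
have lin : scalar (phi0 \o F) by move=> k a b /=; rewrite F_lin phi_lin.
have bd a : cabs ((phi0 \o F) a) <= (`|M| + 1) * nrm a.
  apply: le_trans (phi_bd _) _; apply: le_trans (FM _) _.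
  by rewrite ler_wpM2r ?nrm_ge0// (le_trans (ler_norm _))// lerDl.
apply: (state_of_bounded_positive lin _ _ bd); last by rewrite /= F1.
move=> a; apply: cabs_limit_ge0 => e e0.
(* If [nrm (a - c) < 1], then [nrm c <= nrm a + 1] and [star a * a - star c * c] has norm at most
   [nrm (a - c) * (2 * nrm a + 1)]; the other factor bounds [phi0 \o F] and is positive even when
   [M = 0]. *)
pose K := (`|M| + 1) * (2 * nrm a + 1).
have K0 : 0 < K by rewrite mulr_gt0 ?ltr_wpDl ?mulr_ge0 ?nrm_ge0.
have d0 : 0 < Num.min 1 (e / K) by rewrite lt_min ltr01 divr_gt0.
have : quasi_local_alg iota setT a by rewrite (ql_dense iotaQ).
move=> /(_ _ d0)[c [Lc]]; rewrite lt_min => /andP[d1 de].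
exists ((phi0 \o F) (star c * c)); split.
  have [s [_ /= ->]] := FS _ (sum_of_squares_square Lc).
  rewrite (big_morph phi0 (scalarfD phi_lin) (scalarf0 phi_lin)).
  by apply: sumr_ge0 => d _; exact: phi_pos.
rewrite -scalarfB//; apply: le_lt_trans (bd _) _.
have -> : star a * a - star c * c = star a * (a - c) + star (a - c) * c.
  by rewrite mulrBr starB mulrBl addrA subrK.
have nc : nrm c <= nrm a + 1.
  have -> : c = a + - (a - c) by rewrite subKr.
  by apply: le_trans (nrmD _ _) _; rewrite nrmN lerD2l ltW.
have ne : nrm (star a * (a - c) + star (a - c) * c) <= nrm (a - c) * (2 * nrm a + 1).
  apply: le_trans (nrmD _ _) _.
  have := nrmM (star a) (a - c); have := nrmM (star (a - c)) c.
  rewrite !nrm_star => h1 h2.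
  have := ler_wpM2l (nrm_ge0 (a - c)) nc; lra.
apply: (@le_lt_trans _ _ (nrm (a - c) * K)).
  rewrite /K mulrCA ler_wpM2l// addr_ge0//.
by rewrite -ltr_pdivlMr.
Qed.

End SquarePreservingMaps.

(** * The level maps and stabilization of the states [phi_n] *)

Section ForwardSequence.
Variables (R : realType) (V : choiceType) (adj : rel V) (y1 : V).
Hypothesis N0_empty : forall n y, level adj y1 n y -> N0 adj y1 n y = set0.
Hypothesis Ns_disjoint : forall n y z, level adj y1 n y -> level adj y1 n z ->
  y <> z -> Ns adj y1 n y `&` Ns adj y1 n z = set0.
Variables (Ax : V -> cstarType R) (A : cstarType R) (iota : forall x, Ax x -> A).
Hypothesis iotaQ : quasi_local iota.
Local Notation la := (local_alg iota).
Variables (E Ebar : V -> A -> A).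
Hypothesis E_texp : forall n y, level adj y1 n y ->
  transition_expectation (la (star_at adj y)) (la (Ns adj y1 n y)) (E y).
Hypothesis Ebar_ext : forall n y, level adj y1 n y ->
  extends_by_identity (la (star_at adj y))
    (quasi_local_alg iota (~` star_at adj y)) (E y) (Ebar y).
Variable enum : nat -> seq V.
Hypothesis enum_level : forall n, uniq (enum n) /\ [set` enum n] = level adj y1 n.

Let enumP n y : y \in enum n -> level adj y1 n y.
Proof. by move=> yn; have [_ <-] := enum_level n. Qed.

Lemma levels_map_square_preserving n :
  square_preserving iota (levels_map enum Ebar n).
Proof.
have h m : square_preserving iota (level_map enum Ebar m).
  apply: square_preserving_foldl => y /enumP ym.
  have ET := E_texp ym; have FE := Ebar_ext ym.
  have [Fl Fb _] := FE; split=> //; first exact: extension1 ET FE.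
  by move=> c; apply: extension_sum_of_squares ET FE _ => //; exact: Ns_sub_star.
elim: n => [|n IH]; first exact: h.
exact: (@square_preserving_comp _ _ _ _ _ (level_map enum Ebar n.+1)).
Qed.

(** Each vertex map enlarges the support only by successors of its vertex, which lie in [V_(n+1)]
    and so in [V_m]. *)
Lemma level_map_local_alg n m a : (n < m)%N -> la (Vn adj y1 m) a ->
  la (Vn adj y1 m) (level_map enum Ebar n a).
Proof.
move=> nm; rewrite /level_map; have := @enumP n.
elim: (enum n) a => [//|y s IH] a sn La /=; apply: IH => [z zs|].
  by apply: sn; rewrite inE zs orbT.
have ym : level adj y1 n y by apply: sn; rewrite mem_head.
move: (extension_local_alg iotaQ (E_texp ym) (Ebar_ext ym) La).
by apply: local_alg_mono => x [//|/Ns_sub_Vn]; exact: sub_Vn.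
Qed.

Lemma levels_map_local_alg n m a : (n < m)%N -> la (Vn adj y1 m) a ->
  la (Vn adj y1 m) (levels_map enum Ebar n a).
Proof.
elim: n => [|n IH] nm La; first exact: level_map_local_alg.
by apply: level_map_local_alg => //; apply: IH => //; exact: ltnW.
Qed.

Variables (phix : forall x, Ax x -> R[i]) (phi0 : A -> R[i]).
Hypothesis phi0P : product_state iota phix phi0.
Hypothesis phi0E : forall n y, level adj y1 n y ->
  forall a, la (Np adj y1 n y) a -> phi0 (E y a) = phi0 a.

Lemma product_state_level_map n a : la (Vn adj y1 n) a ->
  phi0 (level_map enum Ebar n a) = phi0 a.
Proof.
rewrite /level_map; have := @enumP n; have [+ _] := enum_level n.
have : forall z, z \in enum n ->
    ~ Vn adj y1 n z /\ Vn adj y1 n `&` Ns adj y1 n z = set0.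
  move=> z /enumP zn; split; first exact: level_notin_Vn.
  by apply/seteqP; split=> // x [xn /Ns_notin_Vn].
(* The support [U] is generalized, since it grows along the enumeration. The invariant is that [U]
   contains no vertex still to be visited and none of its successors. *)
elim: (enum n) (Vn adj y1 n) a => [//|y s IH] U a sU /= /andP[ys us] sn Ua.
have yn : level adj y1 n y by apply: sn; rewrite mem_head.
have [Uy UNs] := sU y (mem_head _ _).
rewrite (IH (U `|` Ns adj y1 n y))//; first 1 last.
- move=> z zs; have zys : z \in y :: s by rewrite inE zs orbT.
  have [Uz UNz] := sU z zys; split.
    by move=> [//|/Ns_notin_level]; apply; exact: sn.
  rewrite setIUl UNz set0U Ns_disjoint//; first exact: sn.
  by move=> yz; move: ys; rewrite yz zs.
- by move=> z zs; apply: sn; rewrite inE zs orbT.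
- have := extension_local_alg iotaQ (E_texp yn) (Ebar_ext yn) Ua; exact.
apply: (extension_product_state iotaQ (@Ns_sub_star _ _ _ n y) (E_texp yn)
  (Ebar_ext yn) phi0P UNs _ (phi0E yn) Ua).
(* A point of [U] in the star of [y] is [y], a predecessor or a successor; the invariant leaves only
   predecessors. *)
move=> x [Ux /(star_at_sub (N0_empty yn))[xy|[//|Nsx]]].
  by case: Uy; rewrite -xy.
by suff : (U `&` Ns adj y1 n y) x by rewrite UNs.
Qed.

Lemma phi_seq_state n : is_state (phi_seq enum Ebar phi0 n).
Proof.
exact: (square_preserving_state iotaQ phi0P.1 (levels_map_square_preserving n)).
Qed.

Hypothesis adj_conn : connected_graph adj.

Lemma phi_seq_strongly_finite :
  strongly_finite_convergent (la setT) (phi_seq enum Ebar phi0).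
Proof.
move=> a [s [us _ Sa]]; have [N sN] := exists_Vn_sub y1 adj_conn s.
exists N => n /subnK <-; elim: (n - N)%N => [//|k <-].
(* The image of [a] after the levels up to [k + N] is still localized in [V_(k+N+1)], exactly where
   the level map of index [k + N + 1] preserves [phi0]. *)
rewrite /phi_seq addSn /= product_state_level_map//.
apply: levels_map_local_alg => //; exists s; split=> //.
by apply: subset_trans sN _; apply: sub_Vn; rewrite -addSn leq_addl.
Qed.

End ForwardSequence.

Theorem theorem2
  (R : realType)
  (* the graph *)
  (V : choiceType) (adj : rel V) (y1 : V)
  (hsimple : simple_graph adj)
  (hinf : infinite_set [set: V])
  (hconn : connected_graph adj)
  (hfin : locally_finite adj)
  (hbip : forall x y, adj x y ->
     (Vinf adj y1 x /\ ~ Vinf adj y1 y) \/ (~ Vinf adj y1 x /\ Vinf adj y1 y))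
  (hN0 : forall n y, level adj y1 n y -> N0 adj y1 n y = set0)
  (hNs : forall n y z, level adj y1 n y -> level adj y1 n z -> y <> z ->
     Ns adj y1 n y `&` Ns adj y1 n z = set0)
  (* the quasi-local algebra *)
  (Ax : V -> cstarType R)
  (hAx : forall x, finite_dimensional (Ax x))
  (A : cstarType R) (iota : forall x, Ax x -> A)
  (hA : quasi_local iota)
  (* the product state *)
  (phix : forall x, Ax x -> R[i])
  (hphix : forall x, is_state (phix x))
  (phi0 : A -> R[i])
  (hphi0 : product_state iota phix phi0)
  (* the transition expectations and their extensions to A *)
  (E : V -> A -> A)
  (hE : forall n y, level adj y1 n y ->
     Markov_transition_expectation
       (local_alg iota (star_at adj y))
       (local_alg iota (Ns adj y1 n y))
       (local_alg iota (y |` Np adj y1 n y))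
       (E y))
  (Ebar : V -> A -> A)
  (hEbar : forall y, Vinf adj y1 y ->
     extends_by_identity
       (local_alg iota (star_at adj y))
       (quasi_local_alg iota (~` star_at adj y))
       (E y) (Ebar y))
  (* the enumerations of the levels *)
  (enum : nat -> seq V)
  (henum : forall n, uniq (enum n) /\ [set` enum n] = level adj y1 n)
  (* the compatibility condition *)
  (hcompat : forall n y, level adj y1 n y ->
     forall a, local_alg iota (Np adj y1 n y) a -> phi0 (E y a) = phi0 a) :
  let phi_ := phi_seq enum Ebar phi0 in
  (forall n, is_state (phi_ n)) /\
  exists phi : A -> R[i],
    [/\ unique (forward_QMF enum Ebar phi0) phi,
        strongly_finite_convergent (local_alg iota setT) phi_,
        unique (fun psi => is_state psi /\
                  strongly_finite_limit (local_alg iota setT) phi_ psi) phi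
      & pointwise_limit phi_ phi].
Proof.
have E_texp n y (yn : level adj y1 n y) := (hE n y yn).1.
have E_ext n y (yn : level adj y1 n y) := hEbar y (level_sub_Vinf yn).
have st n : is_state (phi_seq enum Ebar phi0 n).
  exact: (phi_seq_state hA E_texp E_ext henum hphi0).
split=> //.
have sf := phi_seq_strongly_finite hN0 hNs hA E_texp E_ext henum hphi0
  hcompat hconn.
have [phi [? ? ?]] := strongly_finite_convergence (ql_dense hA) st sf.
by exists phi.
Qed.
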